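(* Let $\mathcal{H},\mathcal{K}$ be complex Hilbert spaces, let $m<M$ be real numbers, and let $A,B\in\mathcal{B}(\mathcal{H})$ be self-adjoint operators such that $mI\le A\le MI$ and $mI\le B\le MI$. Let $\Phi:\mathcal{B}(\mathcal{H})\to\mathcal{B}(\mathcal{K})$ be a normalized positive linear map. If $f:[m,M]\to\mathbb{R}$ is a continuous concave function, then for every $v\in[0,1]$, $$f\bigl(\Phi(A\nabla_v B)\bigr)\le \Phi(f(A))\,\nabla_v\,\Phi(f(B))+2\widetilde{\beta}(m,M,f)\,I.$$
   Context: $\mathcal{B}(\mathcal{H})$ is the $C^*$-algebra of bounded linear operators on $\mathcal{H}$. For self-adjoint $X,Y$, $X\le Y$ means that $Y-X$ is positive (positive semidefinite). A linear map $\Phi$ is positive if $\Phi(X)\ge 0$ whenever $X\ge 0$, and normalized if $\Phi(I)=I$. For $v\in[0,1]$, $X\nabla_v Y=(1-v)X+vY$. $f(X)$ for self-adjoint $X$ is defined by the functional calculus. The constant is $$\widetilde{\beta}(m,M,f)=\max\left\{f(t)-\frac{f(M)-f(m)}{M-m}(t-m)-f(m): m\le t\le M\right\}.$$ *)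

(* Defs.v *)
From HB Require Import structures.
From mathcomp Require Import all_boot all_order all_algebra.
From mathcomp Require Import sesquilinear.
From mathcomp Require Import complex.
From mathcomp Require Import all_classical all_reals all_analysis.

Set Implicit Arguments.
Unset Strict Implicit.
Unset Printing Implicit Defensive.

Import Order.TTheory GRing.Theory Num.Theory.
Import numFieldNormedType.Exports.

Local Open Scope classical_set_scope.
Local Open Scope complex_scope.
Local Open Scope ring_scope.

(* A complex Hilbert space: a complete normed R[i]-module whose norm comes from
   an inner product, linear in its first argument. *)
HB.mixin Record isHilbert (R : realType) H of CompleteNormedModule R[i] H := {
  hdot : {dot H for (@Num.conj R[i])};
  sqr_norm_hdot : forall x : H, `|x| ^+ 2 = hdot x x
}.

#[short(type="hilbertType")]
HB.structure Definition Hilbert (R : realType) :=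
  {H of isHilbert R H & CompleteNormedModule R[i] H}.

Definition is_bounded_operator (R : realType) (H : normedModType R[i])
    (f : H -> H) :=
  linear f /\ exists c : R, forall x : H, `|f x| <= c%:C * `|x|.

Definition bounded_operator (R : realType) (H : normedModType R[i]) :
  {pred H -> H} := [pred f | `[< is_bounded_operator f >]].

Lemma bounded_operator_submod (R : realType) (H : normedModType R[i]) :
  submod_closed (@bounded_operator R H).
Proof.
split=> [|a f g /asboolP[lf [c cP]] /asboolP[lg [d dP]]]; apply/asboolP.
  split=> [b x y|]; first by rewrite /= scaler0 addr0.
  by exists 0 => x; rewrite normr0 rmorph0 mul0r.
split=> [b x y|].
  change (a *: f (b *: x + y) + g (b *: x + y) =
          b *: (a *: f x + g x) + (a *: f y + g y)).
  by rewrite lf lg !scalerDr !scalerA (mulrC a b) addrACA.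
exists (complex.Re `|a| * c + d) => x.
change (`|a *: f x + g x| <= (complex.Re `|a| * c + d)%:C * `|x|).
rewrite rmorphD rmorphM mulrDl (le_trans (ler_normD _ _))// lerD// normrZ.
have aE : (complex.Re `|a|)%:C = `|a| by rewrite RRe_real ?ger0_real.
by rewrite -mulrA /= aE ler_wpM2l.
Qed.

HB.instance Definition _ (R : realType) (H : normedModType R[i]) :=
  GRing.isSubmodClosed.Build R[i] (H -> H) (@bounded_operator R H)
    (bounded_operator_submod H).

(* B(H), with the module structure inherited from H -> H. *)
Record bop (R : realType) (H : normedModType R[i]) := Bop {
  bop_fun :> H -> H;
  _ : bop_fun \in @bounded_operator R H
}.

HB.instance Definition _ (R : realType) (H : normedModType R[i]) :=
  [isSub for @bop_fun R H].
HB.instance Definition _ (R : realType) (H : normedModType R[i]) :=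
  gen_eqMixin (bop H).
HB.instance Definition _ (R : realType) (H : normedModType R[i]) :=
  gen_choiceMixin (bop H).
HB.instance Definition _ (R : realType) (H : normedModType R[i]) :=
  [SubChoice_isSubLmodule of bop H by <:].

Lemma bop_is_linear (R : realType) (H : normedModType R[i]) (X : bop H) :
  linear X.
Proof. by case: X => f /= /asboolP[]. Qed.

HB.instance Definition _ (R : realType) (H : normedModType R[i]) (X : bop H) :=
  GRing.isLinear.Build R[i] H H _ X (bop_is_linear X).

Lemma id_bounded_operator (R : realType) (H : normedModType R[i]) :
  (@id H) \in @bounded_operator R H.
Proof. by apply/asboolP; split=> //; exists 1 => x; rewrite rmorph1 mul1r. Qed.

Lemma comp_bounded_operator (R : realType) (H : normedModType R[i])
  (X Y : bop H) : (X \o Y) \in @bounded_operator R H.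
Proof.
case: X Y => f /= /asboolP[lf [c cP]] [g /= /asboolP[lg [d dP]]].
apply/asboolP; split=> [a x y|]; first by rewrite /= lg lf.
exists (Num.max 0 c * d) => x /=; rewrite (le_trans (cP _))//.
rewrite (@le_trans _ _ ((Num.max 0 c)%:C * `|g x|))//.
  by rewrite ler_wpM2r// lecR le_max lexx orbT.
by rewrite rmorphM -mulrA ler_wpM2l// (lecR 0) le_max lexx.
Qed.

Definition bop_id (R : realType) (H : normedModType R[i]) : bop H :=
  Bop (id_bounded_operator H).

Definition bop_comp (R : realType) (H : normedModType R[i]) (X Y : bop H) :
  bop H := Bop (comp_bounded_operator X Y).

Definition bop_exp (R : realType) (H : normedModType R[i]) (X : bop H)
  (n : nat) : bop H := iter n (bop_comp X) (bop_id H).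

(* p(X); the ring structures that polynomial evaluation in the library asks for
   are not available, since bop H is the trivial ring when H = 0. *)
Definition bop_poly (R : realType) (H : normedModType R[i]) (p : {poly R})
  (X : bop H) : bop H := \sum_(i < size p) (p`_i)%:C *: bop_exp X i.

(* The norm of H is R[i]-valued, hence the real part. *)
Definition bop_norm (R : realType) (H : normedModType R[i]) (X : bop H) : R :=
  sup [set complex.Re `|X x| | x in [set x : H | `|x| <= 1]].

Definition bop_invertible (R : realType) (H : normedModType R[i])
  (X : bop H) :=
  exists Y : bop H, bop_comp X Y = bop_id H /\ bop_comp Y X = bop_id H.

Definition spectrum (R : realType) (H : normedModType R[i]) (X : bop H) :
  set R[i] := [set l | ~ bop_invertible (X - l *: bop_id H)].

Definition real_spectrum (R : realType) (H : normedModType R[i])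
  (X : bop H) : set R := [set t | spectrum X t%:C].

Definition self_adjoint (R : realType) (H : hilbertType R) (X : bop H) :=
  forall x y : H, hdot (X x) y = hdot x (X y).

(* In the order of R[i], 0 <= z implies that z is real. *)
Definition positive_bop (R : realType) (H : hilbertType R) (X : bop H) :=
  forall x : H, 0 <= hdot (X x) x.

Definition bop_le (R : realType) (H : hilbertType R) (X Y : bop H) :=
  positive_bop (Y - X).

(* Y = f(X) in the continuous functional calculus: Y is a norm limit of
   polynomials p_n(X) with p_n --> f uniformly on the spectrum, which is real
   for self-adjoint X. *)
Definition is_fcalc (R : realType) (H : hilbertType R) (f : R -> R)
    (X Y : bop H) :=
  exists p : nat -> {poly R},
    {uniform real_spectrum X, (fun n t => (p n).[t]) @ \oo --> f} /\
    bop_norm (bop_poly (p n) X - Y) @[n --> \oo] --> (0 : R).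

(* For X self-adjoint and f continuous on the spectrum of X there is exactly one
   Y such that is_fcalc f X Y; otherwise the value is irrelevant. *)
Definition fcalc (R : realType) (H : hilbertType R) (f : R -> R) (X : bop H) :
  bop H := xget 0 [set Y | is_fcalc f X Y].

Definition positive_map (R : realType) (H K : hilbertType R)
  (Phi : {linear bop H -> bop K}) :=
  forall X : bop H, positive_bop X -> positive_bop (Phi X).

Definition normalized_map (R : realType) (H K : hilbertType R)
  (Phi : {linear bop H -> bop K}) := Phi (bop_id H) = bop_id K.

(* X \nabla_v Y: the weight v is on Y. *)
Definition wmean (R : realType) (H : hilbertType R) (v : R) (X Y : bop H) :
  bop H := (1 - v)%:C *: X + v%:C *: Y.

Definition concave_function (R : realType) (D : set R) (f : R -> R) :=
  @convex_function R R^o D (\- f).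

(* This is a maximum: for f continuous on [m, M] the supremum is
   attained. *)
Definition beta_tilde (R : realType) (m M : R) (f : R -> R) : R :=
  sup [set f t - (f M - f m) / (M - m) * (t - m) - f m | t in `[m, M]].

(* Main.v *)
(* Let L be the chord of f over [m, M] and beta = beta_tilde m M f, so that
   L <= f <= L + beta on [m, M] by concavity, and let C = Phi (A nabla_v B), so
   that m <= C <= M. As L is affine and Phi is linear and unital,
     f(C) <= L(C) + beta = Phi(L(A)) nabla_v Phi(L(B)) + beta
          <= Phi(f(A)) nabla_v Phi(f(B)) + beta,
   and beta >= 0.
   Scalar inequalities pass to operators because p(X) >= 0 when X is
   self-adjoint and p >= 0 on its spectrum: the infimum of the numerical range
   of p(X) is a spectral value a of p(X), and factoring p - a over the complex
   numbers gives a = p(t) with t in the spectrum of X. The same bound makes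
   p_n(X) a Cauchy sequence when the polynomials p_n tend to f uniformly on
   [m, M], so that f(X) exists. *)
Require Import Defs.
From mathcomp Require Import all_boot all_order all_algebra.
From mathcomp Require Import complex.
From mathcomp Require Import all_classical all_reals all_analysis.
From mathcomp Require Import ring lra.

Set Implicit Arguments.
Unset Strict Implicit.
Unset Printing Implicit Defensive.

Import Order.TTheory GRing.Theory Num.Theory.
Import numFieldNormedType.Exports.

Local Open Scope classical_set_scope.
Local Open Scope complex_scope.
Local Open Scope ring_scope.

(** * Weierstrass approximation *)

Section weierstrass.
Context {R : realType}.
Implicit Types (g h : nat -> R) (x t : R).

(* [\sum_(k <= n) g k *: 'C(n, k) *: 'X^k * (1 - 'X) ^+ (n - k)], unfolded along
   Pascal's rule; the classical choice is [g k = f (k / n)]. *)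
Fixpoint bernstein (n : nat) (g : nat -> R) : {poly R} :=
  if n is n'.+1 then 'X * bernstein n' (g \o S) + (1 - 'X) * bernstein n' g
  else (g 0%N)%:P.

Lemma bernsteinS n g x : (bernstein n.+1 g).[x] =
  x * (bernstein n (g \o S)).[x] + (1 - x) * (bernstein n g).[x].
Proof. by rewrite /= !hornerE. Qed.

Lemma le_bernstein n g h x : 0 <= x <= 1 ->
  (forall k, (k <= n)%N -> g k <= h k) ->
  (bernstein n g).[x] <= (bernstein n h).[x].
Proof.
move=> /andP[x0 x1]; elim: n g h => [|n IH] g h gh;
  first by rewrite /= !hornerE gh.
rewrite !bernsteinS lerD// ler_wpM2l ?subr_ge0//.
  by apply: IH => k kn; exact: gh.
by apply: IH => k kn; apply: gh; rewrite (leq_trans kn).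
Qed.

(** Mean and variance of the binomial law, whose probabilities are the weights of [bernstein] at
    [x]. The centre [c] is left free because the Pascal step of the induction shifts it by one. *)
Lemma bernstein_quad n (a b c : R) x :
  (bernstein n (fun k => a + b * (k%:R - c) ^+ 2)).[x] =
  a + b * (n%:R * x * (1 - x) + (n%:R * x - c) ^+ 2).
Proof.
elim: n c => [|n IH] c; first by rewrite /= !hornerE; ring.
rewrite bernsteinS IH.
rewrite (_ : _ \o S = fun k => a + b * (k%:R - (c - 1)) ^+ 2); last first.
  by apply/funext => k /=; rewrite -natr1; ring.
by rewrite IH -natr1; ring.
Qed.

(** Chebyshev-type estimate: [g] lies between two quadratics centred at [n x], whose Bernstein
    polynomials are explicit; monotonicity and [x (1 - x) <= 1] conclude. *)
Lemma bernstein_near n g (y e b x : R) : 0 <= x <= 1 -> 0 <= b ->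
  (forall k, (k <= n)%N -> `|g k - y| <= e + b * (k%:R - n%:R * x) ^+ 2) ->
  `|(bernstein n g).[x] - y| <= e + b * n%:R.
Proof.
move=> x01 b0 gy.
have E a c : (bernstein n (fun k => a + c * (k%:R - n%:R * x) ^+ 2)).[x] =
    a + c * (n%:R * (x * (1 - x))).
  by rewrite bernstein_quad subrr; ring.
have xx : b * (n%:R * (x * (1 - x))) <= b * n%:R.
  rewrite ler_wpM2l// ler_piMr//; nra.
rewrite ler_distl; apply/andP; split.
  rewrite (@le_trans _ _ (bernstein n
      (fun k => (y - e) + (- b) * (k%:R - n%:R * x) ^+ 2)).[x])//.
    by rewrite E; lra.
  by apply: le_bernstein => // k /gy; rewrite ler_distl => /andP[]; lra.
rewrite (@le_trans _ _ (bernstein n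
    (fun k => (y + e) + b * (k%:R - n%:R * x) ^+ 2)).[x])//.
  by apply: le_bernstein => // k /gy; rewrite ler_distl => /andP[]; lra.
by rewrite E; lra.
Qed.

(** Heine-Cantor, by compactness of the segment in near-covering form; the modulus is the parameter,
    tending to 0 from the right. *)
Lemma within_itv_unif_continuous (m M : R) (f : R -> R) (e : R) : 0 < e ->
  {within `[m, M], continuous f} ->
  exists2 d : R, 0 < d & forall x y, m <= x <= M -> m <= y <= M ->
    `|x - y| < d -> `|f x - f y| <= e.
Proof.
move=> e0 /subspace_continuousP fc.
have /compact_near_coveringP/(_ R (0^'+) (fun d x => x \in `[m, M] ->
    forall y, m <= y <= M -> `|x - y| < d -> `|f x - f y| <= e)) :=
    @segment_compact _ m M.
case.
- move=> x mxM.
  have /cvgrPdist_lt/(_ (e / 2)) := fc x mxM.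
  rewrite divr_gt0// => /(_ isT); rewrite /within/= => /nbhs_ballP[d /= d0 dP].
  (* The radius is halved so that [y], at distance less than [d / 2] from [x'], still lies in the
     [d]-ball around [x]. *)
  exists (ball x (d / 2), [set r | 0 < r < d / 2]) => /=.
    split; first by apply: nbhsx_ballx; rewrite divr_gt0.
    near=> r; apply/andP; split; first by near: r; exact: nbhs_right_gt.
    by near: r; apply: nbhs_right_lt; rewrite divr_gt0.
  move=> [x' r] /= [xx' /andP[r0 rd]] x'I y yI yr.
  rewrite /ball/= in xx' dP.
  have := dP x'; have := dP y => /=; rewrite in_itv/= in x'I *.
  have d2 : d / 2 < d by rewrite ltr_pdivrMr// ltr_pMr// ltr1n.
  have /[swap]/[apply]/(_ yI) : `|x - y| < d.
    rewrite (le_lt_trans (ler_distD x' _ _))// [ltRHS](splitr d) ltrD//.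
    exact: lt_trans rd.
  move=> fy /(_ (lt_trans xx' d2) x'I) fx'.
  rewrite (le_trans (ler_distD (f x) _ _))// [leRHS](splitr e) ltW// ltrD//.
  by rewrite distrC.
- move=> d /= d0 dP; exists (d / 2); first by rewrite divr_gt0.
  move=> x y xI yI xy; apply: (dP (d / 2)) => //=.
  + by rewrite sub0r normrN gtr0_norm ?divr_gt0// ltr_pdivrMr// ltr_pMr// ltr1n.
  + by rewrite divr_gt0.
Unshelve. all: by end_near. Qed.

Theorem weierstrass_approximation (m M : R) (f : R -> R) (e : R) : m < M ->
  0 < e -> {within `[m, M], continuous f} ->
  exists p : {poly R}, forall t, m <= t <= M -> `|p.[t] - f t| <= e.
Proof.
move=> mM e0 fc; have e20 : 0 < e / 2 by rewrite divr_gt0.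
have [d d0 dP] := within_itv_unif_continuous e20 fc.
have [c cI cmax] := EVT_max (ltW mM) fc.
have [c' c'I cmin] := EVT_min (ltW mM) fc.
pose K := f c - f c'; have K0 : 0 <= K by rewrite subr_ge0 cmin.
have fK x y : m <= x <= M -> m <= y <= M -> `|f x - f y| <= K.
  move=> xI yI; rewrite ler_distl; have := cmax x; have := cmax y.
  have := cmin x; have := cmin y; rewrite !in_itv/= xI yI /K.
  by do 4 move=> /(_ isT) ?; apply/andP; split; lra.
pose w := M - m; have w0 : 0 < w by rewrite subr_gt0.
(* This size of [n] makes the variance term [b n], with [b] as below, at most [e / 2]. *)
pose n := (Num.truncn (K * w ^+ 2 / d ^+ 2 / (e / 2))).+1.
have n0 : (0 : R) < n%:R by rewrite ltr0n.
have nE : K * w ^+ 2 / d ^+ 2 <= e / 2 * n%:R.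
  by rewrite (mulrC (e / 2)) -ler_pdivrMr// ltW// truncnS_gt.
move: n n0 nE => n n0 nE.
(* At the sample point [y = m + w k / n], the quadratic [b (k - n x) ^ 2] equals
   [K (|y - t| / d) ^ 2]. It dominates the oscillation [K] once [|y - t| >= d]; closer to [t],
   uniform continuity gives [e / 2]. *)
pose b := K * w ^+ 2 / d ^+ 2 / n%:R ^+ 2.
pose g (k : nat) := f (m + w * k%:R / n%:R).
have b0 : 0 <= b by rewrite !(divr_ge0, mulr_ge0, exprn_ge0)// ltW.
exists (bernstein n g \Po (w^-1 *: ('X - m%:P))) => t tI.
rewrite horner_comp !hornerE.
have tx : w^-1 * (t - m) = (t - m) / w by rewrite mulrC.
rewrite tx; set x := (t - m) / w.
have tE : t = m + w * x by rewrite /x; field; rewrite gt_eqF.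
have x01 : 0 <= x <= 1.
  by rewrite /x divr_ge0 ?ler_pdivrMr//= /w; lra.
rewrite (le_trans (@bernstein_near n g (f t) (e / 2) b x x01 b0 _))//.
  move=> k kn; set y := m + w * k%:R / n%:R.
  have kn01 : 0 <= (k%:R / n%:R : R) <= 1.
    by rewrite divr_ge0//= ler_pdivrMr// mul1r ler_nat.
  have yI : m <= y <= M.
    case/andP: kn01 => k0 k1; have := ler_wpM2l (ltW w0) k1.
    have := mulr_ge0 (ltW w0) k0; rewrite /y -mulrA /w; lra.
  have quad0 : 0 <= b * (k%:R - n%:R * x) ^+ 2 by rewrite mulr_ge0// sqr_ge0.
  have [yt|yt] := ltP `|y - t| d.
    by rewrite (le_trans (dP _ _ yI tI yt))// lerDl.
  rewrite (le_trans (fK _ _ yI tI))// -[leLHS]add0r lerD//; first exact: ltW.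
  have -> : b * (k%:R - n%:R * x) ^+ 2 = K * (`|y - t| / d) ^+ 2.
    rewrite expr_div_n real_normK ?num_real// /b /y tE; field.
    by rewrite !gt_eqF.
  by rewrite ler_peMr// exprn_ege1// ler_pdivlMr// mul1r.
rewrite [leRHS](splitr e) lerD2l /b.
have -> : K * w ^+ 2 / d ^+ 2 / n%:R ^+ 2 * n%:R = K * w ^+ 2 / d ^+ 2 / n%:R.
  by field; rewrite !gt_eqF.
by rewrite ler_pdivrMr.
Qed.

End weierstrass.

(** * The real inner product of a Hilbert space *)

Section hilbert.
Context {R : realType} {H : hilbertType R}.
Implicit Types (x y z : H) (a b : R) (X Y T : bop H).

(** The real part of [hdot] is a real inner product with the same norm; it keeps all estimates
    inside the ordered field [R]. *)
Definition rnorm x : R := complex.Re `|x|.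
Definition rdot x y : R := complex.Re (hdot x y).

Lemma rnormE x : `|x| = (rnorm x)%:C.
Proof. by rewrite /rnorm RRe_real// ger0_real. Qed.

Lemma rnorm_ge0 x : 0 <= rnorm x.
Proof. by rewrite -ler0c -rnormE. Qed.

Lemma rnorm_eq0 x : (rnorm x == 0) = (x == 0).
Proof. by rewrite -(normr_eq0 x) rnormE (inj_eq (@complexI _)). Qed.

Lemma rnormD x y : rnorm (x + y) <= rnorm x + rnorm y.
Proof. by have := ler_normD x y; rewrite !rnormE -rmorphD lecR. Qed.

Lemma rnormN x : rnorm (- x) = rnorm x.
Proof. by rewrite /rnorm normrN. Qed.

Lemma rnormB x y : rnorm (x - y) = rnorm (y - x).
Proof. by rewrite -opprB rnormN. Qed.

Lemma rnorm_dist z x y : rnorm (x - y) <= rnorm (x - z) + rnorm (z - y).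
Proof. by rewrite (le_trans _ (rnormD _ _))// addrA subrK. Qed.

Lemma rnormZ a x : rnorm (a%:C *: x) = `|a| * rnorm x.
Proof.
apply: complexI; rewrite -rnormE normrZ rnormE rmorphM; congr (_ * _).
by rewrite normc_def /= expr0n /= addr0 sqrtr_sqr.
Qed.

Lemma rnormZC (k : R[i]) x : rnorm (k *: x) = complex.Re `|k| * rnorm x.
Proof.
rewrite /rnorm normrZ !rnormE.
by rewrite -[`|k|]RRe_real ?ger0_real// -rmorphM.
Qed.

Lemma rnorm0 : rnorm 0 = 0.
Proof. by apply/eqP; rewrite rnorm_eq0. Qed.

Lemma rdotxx x : rdot x x = rnorm x ^+ 2.
Proof. by rewrite /rdot -sqr_norm_hdot rnormE -rmorphXn. Qed.

Lemma rdotC x y : rdot x y = rdot y x.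
Proof.
rewrite /rdot hermC /= expr0 mul1r.
by case: (hdot y x).
Qed.

Lemma rdotDl x y z : rdot (x + y) z = rdot x z + rdot y z.
Proof. by rewrite /rdot linearDl raddfD. Qed.

Lemma rdotDr x y z : rdot z (x + y) = rdot z x + rdot z y.
Proof. by rewrite /rdot linearDr raddfD. Qed.

Lemma rdotZl a x y : rdot (a%:C *: x) y = a * rdot x y.
Proof. by rewrite /rdot linearZl_LR /=; case: (hdot x y) => u w /=; ring. Qed.

Lemma rdotZr a x y : rdot x (a%:C *: y) = a * rdot x y.
Proof. by rewrite rdotC rdotZl rdotC. Qed.

Lemma rdotNl x y : rdot (- x) y = - rdot x y.
Proof. by rewrite -scaleN1r -(rmorphN1 (real_complex R)) rdotZl mulN1r. Qed.

Lemma rdotNr x y : rdot x (- y) = - rdot x y.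
Proof. by rewrite rdotC rdotNl rdotC. Qed.

Lemma rdot0l x : rdot 0 x = 0.
Proof. by have := rdotZl 0 0 x; rewrite scaler0 mul0r. Qed.

Definition rdotE := (rdotDl, rdotDr, rdotNl, rdotNr, rdotZl, rdotZr).

(** Cauchy-Schwarz: expand the squared norm of [rnorm y x - rnorm x y]. Replacing [x] by [- x] gives
    the other sign. *)
Lemma rdot_rnorm x y : `|rdot x y| <= rnorm x * rnorm y.
Proof.
suff S u w : rdot u w <= rnorm u * rnorm w.
  by rewrite ler_norml S lerNl -rdotNl -(rnormN x) S.
move: u w => {x y} x y.
have [->|y0] := eqVneq y 0.
  by rewrite rdotC rdot0l mulr_ge0// rnorm_ge0.
have [->|x0] := eqVneq x 0.
  by rewrite rdot0l mulr_ge0// rnorm_ge0.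
have gt0 z : z != 0 -> 0 < rnorm z by rewrite lt_def rnorm_ge0 rnorm_eq0 andbT.
have := sqr_ge0 (rnorm ((rnorm y)%:C *: x - (rnorm x)%:C *: y)).
rewrite -rdotxx !rdotE !rdotxx (rdotC y x) => h.
have nn := mulr_gt0 (gt0 _ x0) (gt0 _ y0).
rewrite -subr_ge0 -(pmulr_rge0 _ nn); nra.
Qed.

(** Completeness with a rate: comparing with a term beyond both [n] and the convergence threshold
    carries the bound [e n] over to the limit. *)
Lemma hilbert_complete (u : nat -> H) (e : nat -> R) : e @ \oo --> 0 ->
  (forall n k, (n <= k)%N -> rnorm (u n - u k) <= e n) ->
  exists l, forall n, rnorm (u n - l) <= e n.
Proof.
move=> e0 uP.
have lt_rnorm x r : 0 < r -> (`|x| < r) = (rnorm x < complex.Re r).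
  case: r => r s; rewrite ltcE /= => /andP[/eqP -> _].
  by rewrite rnormE; exact: ltcR.
have /cvg_ex[l ul] : cvg (u @ \oo).
  apply/cauchy_cvgP/cauchy_exP => r r0.
  have r0' : 0 < complex.Re r by move: r0; rewrite ltcE => /andP[].
  have /cvgrPdist_lt/(_ _ r0')[N _ /(_ N (leqnn N)) eN] := e0.
  exists (u N); exists N => // k /= Nk; rewrite -ball_normE /= lt_rnorm//.
  apply: le_lt_trans eN; rewrite sub0r normrN.
  exact: le_trans (uP _ _ Nk) (ler_norm _).
exists l => n; apply/ler_addgt0Pr => r r0.
have : (0 : R[i]) < r%:C by rewrite ltcR.
move: ul => /cvgrPdist_lt/[apply] -[N _ NP].
have := NP (maxn n N) (leq_maxr _ _); rewrite rnormE ltcR => lu.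
rewrite (le_trans (rnorm_dist (u (maxn n N)) _ _))// lerD ?uP ?leq_maxl//.
by rewrite rnormB ltW.
Qed.

Lemma rnorm_cvg0_eq0 (z : H) (e : nat -> R) : e @ \oo --> 0 ->
  (forall n, rnorm z <= e n) -> z = 0.
Proof.
move=> e0 ze; apply/eqP; rewrite -rnorm_eq0 eq_le rnorm_ge0 andbT.
by apply: (ler_cvg_to (cvg_cst _) e0); exact: nearW.
Qed.

End hilbert.

(** * Bounded operators and coercivity *)

Section operators.
Context {R : realType} {H : hilbertType R}.
Implicit Types (x y z : H) (a b c : R) (X Y T : bop H).

Lemma bopP X Y : X =1 Y -> X = Y.
Proof. by move=> XY; apply: val_inj; apply/funext. Qed.

Lemma bopDE X Y x : (X + Y) x = X x + Y x. Proof. by []. Qed.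

Lemma bopZE (k : R[i]) X x : (k *: X) x = k *: X x. Proof. by []. Qed.

Lemma bopNE X x : (- X) x = - X x. Proof. by []. Qed.

Lemma bop_idE x : bop_id H x = x. Proof. by []. Qed.

Lemma bop_compE X Y x : bop_comp X Y x = X (Y x). Proof. by []. Qed.

Definition bopE := (bopDE, bopNE, bopZE, bop_idE, bop_compE).

Lemma bop_sumE n (F : 'I_n -> bop H) x :
  (\sum_(i < n) F i) x = \sum_(i < n) F i x.
Proof.
elim/big_rec2: _ => [//|i y z _ <-]; exact: bopDE.
Qed.

Lemma bop_bounded X : exists2 N, 0 < N & forall x, rnorm (X x) <= N * rnorm x.
Proof.
case: X => f /= /asboolP[_ [c cP]]; exists (Num.max c 1).
  by rewrite lt_max ltr01 orbT.
move=> x; have := cP x; rewrite !rnormE -rmorphM lecR => /le_trans; apply.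
by rewrite ler_wpM2r ?rnorm_ge0// le_max lexx.
Qed.

Lemma bop_of_bounded_linear (f : H -> H) c : linear f ->
  (forall x, rnorm (f x) <= c * rnorm x) -> exists X : bop H, X =1 f.
Proof.
move=> lf fc; have fb : f \in @bounded_operator R H.
  by apply/asboolP; split=> //; exists c => x; rewrite !rnormE -rmorphM lecR.
by exists (Bop fb).
Qed.

Lemma bop_invertibleP X :
  bop_invertible X <-> exists Y : bop H, cancel X Y /\ cancel Y X.
Proof.
split=> -[Y [XY YX]]; exists Y; split.
- by move=> x; rewrite -bop_compE YX.
- by move=> x; rewrite -bop_compE XY.
- by apply/bopP => x; exact: YX.
- by apply/bopP => x; exact: XY.
Qed.

Lemma bop_invertibleZ (k : R[i]) X : k != 0 -> bop_invertible X ->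
  bop_invertible (k *: X).
Proof.
move=> k0 /bop_invertibleP[Y [XY YX]]; apply/bop_invertibleP.
by exists (k^-1 *: Y); split=> x; rewrite !bopE linearZ/= scalerA;
  rewrite ?(mulVf, mulfV)// scale1r ?XY ?YX.
Qed.

Lemma bop_invertible_comp X Y : bop_invertible X -> bop_invertible Y ->
  bop_invertible (bop_comp X Y).
Proof.
move=> /bop_invertibleP[X' [XX' X'X]] /bop_invertibleP[Y' [YY' Y'Y]].
by apply/bop_invertibleP; exists (bop_comp Y' X'); split; apply: can_comp.
Qed.

(** Cauchy-Schwarz divided by [rnorm x]. The bound gives both injectivity of [T] and continuity of
    its inverse. *)
Lemma coercive_injective T c : 0 < c ->
  (forall x, c * rnorm x ^+ 2 <= rdot (T x) x) ->
  forall x, c * rnorm x <= rnorm (T x).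
Proof.
move=> c0 Tc x; have := Tc x; have := rdot_rnorm (T x) x.
rewrite ler_norml => /andP[_ h1 h2].
have [->|x0] := eqVneq x 0.
  by rewrite rnorm0 mulr0 rnorm_ge0.
have nx : 0 < rnorm x by rewrite lt_def rnorm_ge0 rnorm_eq0 x0.
by rewrite -(ler_pM2r nx) -mulrA -expr2 (le_trans h2).
Qed.

(* [x] solves [T x = y] iff it is fixed by [x |-> x - r (T x - y)], which is a
   contraction for [r = c / N ^ 2], where [N] bounds the norm of [T]. *)
Lemma coercive_surjective T c : 0 < c ->
  (forall x, c * rnorm x ^+ 2 <= rdot (T x) x) ->
  forall y, exists x, T x = y.
Proof.
move=> c0 Tc y.
(* [N] is enlarged to at least [c], so that [c / N <= 1] and the factor [q] below is nonnegative. *)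
have [N cN NP] : exists2 N, c <= N & forall x, rnorm (T x) <= N * rnorm x.
  have [N N0 NP] := bop_bounded T; exists (Num.max N c).
    by rewrite le_max lexx orbT.
  move=> x; rewrite (le_trans (NP x))// ler_wpM2r ?rnorm_ge0//.
  by rewrite le_max lexx.
have N0 : 0 < N by exact: lt_le_trans cN.
(* With [p = (c / N) ^ 2], expanding the squared norm of [w - r T w] leaves the factor [1 - p]; as
   [1 - p <= (1 - p / 2) ^ 2], the choice of [q] avoids a square root. *)
pose r := c / N ^+ 2; pose q := 1 - (c / N) ^+ 2 / 2.
have cN01 : 0 < c / N <= 1 by rewrite divr_gt0//= ler_pdivrMr// mul1r.
have q0 : 0 <= q by rewrite /q; nra.
have q1 : q < 1 by rewrite /q; nra.
pose g x := x - r%:C *: (T x - y).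
have gq x z : rnorm (g x - g z) <= q * rnorm (x - z).
  have -> : g x - g z = (x - z) - r%:C *: T (x - z).
    have -> : T (x - z) = (T x - y) - (T z - y).
      by rewrite raddfB opprB addrA subrK.
    by rewrite /g (scalerBr _ (T x - y)) !opprD !opprK addrACA.
  move: (x - z) => w.
  rewrite -(ler_pXn2r (_ : 0 < 2)%N) ?nnegrE ?mulr_ge0 ?rnorm_ge0//.
  rewrite -rdotxx !rdotE !rdotxx (rdotC w).
  have h1 := Tc w; have h2 : rnorm (T w) ^+ 2 <= N ^+ 2 * rnorm w ^+ 2.
    by rewrite -exprMn lerXn2r ?nnegrE ?mulr_ge0 ?rnorm_ge0// ltW.
  have r0 : 0 <= r by rewrite divr_ge0 ?sqr_ge0// ltW.
  have h3 := ler_wpM2l r0 h1; have h4 := ler_wpM2l (mulr_ge0 r0 r0) h2.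
  have rN : r * N ^+ 2 = c by rewrite /r divfK// gt_eqF// exprn_gt0.
  have rc : r * c = (c / N) ^+ 2 by rewrite /r; field; rewrite gt_eqF.
  have h5 : r * r * (N ^+ 2 * rnorm w ^+ 2) = (c / N) ^+ 2 * rnorm w ^+ 2.
    by rewrite -rc -[in RHS]rN; ring.
  have h6 : r * (c * rnorm w ^+ 2) = (c / N) ^+ 2 * rnorm w ^+ 2.
    by rewrite -rc; ring.
  rewrite h5 in h4; rewrite h6 in h3; rewrite exprMn /q.
  have := sqr_ge0 (rnorm w); have := sqr_ge0 (c / N); set p := (c / N) ^+ 2.
  rewrite -/p in h3 h4; set s := rnorm w ^+ 2 in h3 h4 *; move=> p0 s0.
  have := mulr_ge0 s0 (sqr_ge0 p); lra.
(* [D] is the sum of the geometric series bounding the steps of the orbit, hence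
   [D = rnorm (u 0 - u 1) + q D]. *)
pose u n := iter n g 0; pose D := rnorm (u 0%N - u 1%N) / (1 - q).
have q1' : 0 < 1 - q by rewrite subr_gt0.
have u0 k : rnorm (u 0%N - u k) <= D.
  elim: k => [|k IH].
    by rewrite subrr rnorm0 divr_ge0 ?rnorm_ge0// ltW.
  rewrite (le_trans (rnorm_dist (u 1%N) _ _))//.
  have -> : D = rnorm (u 0%N - u 1%N) + q * D.
    by rewrite /D; field; rewrite gt_eqF.
  by rewrite lerD2l (le_trans (gq _ _))// ler_wpM2l.
have uP n k : (n <= k)%N -> rnorm (u n - u k) <= D * q ^+ n.
  elim: n k => [|n IH] [|k]//; rewrite ?expr0 ?mulr1//.
  rewrite ltnS => nk; rewrite (le_trans (gq _ _))// exprS mulrCA ler_wpM2l//.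
  exact: IH.
have e0 : (D * q ^+ n) @[n --> \oo] --> 0.
  by apply: cvg_geometric; rewrite ger0_norm.
have [l lP] := hilbert_complete e0 uP.
have gl : g l = l.
  apply/eqP; rewrite -subr_eq0; apply/eqP.
  have e0' : (2 * (D * q ^+ n)) @[n --> \oo] --> 0.
    by rewrite -[0](mulr0 2); exact: cvgMr.
  apply: (rnorm_cvg0_eq0 e0') => n.
  rewrite (le_trans (rnorm_dist (u n.+1) _ _))// mulr_natl mulr2n.
  have Dq : D * q ^+ n.+1 <= D * q ^+ n.
    rewrite exprSr mulrA ler_piMr ?(ltW q1)//.
    by rewrite mulr_ge0 ?exprn_ge0// divr_ge0 ?rnorm_ge0// ltW.
  rewrite lerD//; last exact: le_trans (lP _) Dq.
  rewrite rnormB (le_trans (gq _ _))// (le_trans (ler_wpM2l q0 (lP n)))//.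
  by rewrite mulrCA -exprS.
have r0 : r%:C != 0 :> R[i].
  by rewrite (inj_eq (@complexI _) r 0) gt_eqF// divr_gt0// exprn_gt0.
move/eqP: gl; rewrite /g -subr_eq0 addrAC subrr sub0r oppr_eq0 scaler_eq0.
by rewrite (negPf r0) subr_eq0 => /eqP; exists l.
Qed.

(** Lax-Milgram: preimages are chosen pointwise; injectivity makes the choice linear, and the lower
    bound on [T] makes it bounded by [c^-1]. *)
Lemma coercive_invertible T c : 0 < c ->
  (forall x, c * rnorm x ^+ 2 <= rdot (T x) x) -> bop_invertible T.
Proof.
move=> c0 Tc; have [W TW] := choice (coercive_surjective c0 Tc).
have Tn := coercive_injective c0 Tc.
have Tinj x y : T x = T y -> x = y.
  move=> xy; apply/eqP; rewrite -subr_eq0 -rnorm_eq0 eq_le rnorm_ge0 andbT.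
  have := Tn (x - y); rewrite linearB /= xy subrr.
  by rewrite rnorm0 pmulr_rle0.
have [||Y YW] := @bop_of_bounded_linear W c^-1.
- by move=> k x y; apply: Tinj; rewrite linearP /= !TW.
- by move=> x; have := Tn (W x); rewrite TW ler_pdivlMl.
exists Y; split; apply/bopP => x; rewrite bop_compE YW.
  by rewrite TW.
by apply: Tinj; rewrite TW.
Qed.

End operators.

(** * Spectrum of self-adjoint operators *)

Section spectrum.
Context {R : realType} {H : hilbertType R}.
Implicit Types (x y z : H) (a b c : R) (X Y T : bop H).

Lemma hdotxx x : hdot x x = (rnorm x ^+ 2)%:C.
Proof. by rewrite -sqr_norm_hdot rnormE -rmorphXn. Qed.

Lemma hdotC x y : hdot y x = (hdot x y)^*%C.
Proof. by rewrite hermC /= expr0 mul1r. Qed.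

Lemma bopDr X x y : X (x + y) = X x + X y. Proof. exact: linearD. Qed.

Lemma bopZr X (k : R[i]) x : X (k *: x) = k *: X x. Proof. exact: linearZ. Qed.

Lemma hdotDl x y z : hdot (x + y) z = hdot x z + hdot y z.
Proof. exact: linearDl. Qed.

Lemma hdotDr x y z : hdot z (x + y) = hdot z x + hdot z y.
Proof. exact: linearDr. Qed.

Lemma hdotZl (k : R[i]) x y : hdot (k *: x) y = k * hdot x y.
Proof. exact: linearZl_LR. Qed.

Lemma hdotZr (k : R[i]) x y : hdot x (k *: y) = k^*%C * hdot x y.
Proof. exact: linearZr_LR. Qed.

(** Brings imaginary parts within reach of [rdot_rnorm]. *)
Lemma Im_hdot x y : complex.Im (hdot x y) = rdot x ('i%C *: y).
Proof.
rewrite rdotC /rdot hdotZl /= hdotC.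
by case: (hdot y x) => u v /=; ring.
Qed.

Lemma self_adjoint_rdot X x y : self_adjoint X -> rdot (X x) y = rdot x (X y).
Proof. by move=> Xsa; rewrite /rdot Xsa. Qed.

Lemma positive_bopP X : positive_bop X <->
  (forall x, complex.Im (hdot (X x) x) = 0 /\ 0 <= rdot (X x) x).
Proof.
split=> P x; have := P x.
  by rewrite lecE /= => /andP[/eqP-> ->].
by rewrite lecE /= => -[-> ->]; rewrite eqxx.
Qed.

Lemma self_adjoint_Im X x : self_adjoint X -> complex.Im (hdot (X x) x) = 0.
Proof.
move=> Xsa; have := hdotC (X x) x; rewrite -Xsa.
case: (hdot (X x) x) => u v [] /eqP.
by rewrite -addr_eq0 -mulr2n mulrn_eq0 => /eqP.
Qed.

Lemma self_adjoint_positive X : self_adjoint X ->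
  (forall x, 0 <= rdot (X x) x) -> positive_bop X.
Proof.
move=> Xsa P; apply/positive_bopP => x; split=> //; exact: self_adjoint_Im.
Qed.

(** Polarization: the quadratic form is real at [x + y] and at [x + i y], which settles the
    imaginary and the real part respectively. *)
Lemma positive_bop_self_adjoint X : positive_bop X -> self_adjoint X.
Proof.
move=> /positive_bopP P x y.
have P0 z : complex.Im (hdot (X z) z) = 0 by case: (P z).
rewrite [RHS]hdotC; apply/eqP.
have := P0 (x + y); rewrite bopDr !(hdotDl, hdotDr).
have := P0 (x + 'i%C *: y).
rewrite bopDr bopZr /= !(hdotDl, hdotDr, hdotZl, hdotZr).
have := P0 x; have := P0 y.
case: (hdot (X x) x) (hdot (X y) y) => [? ?] [? ?].
case: (hdot (X x) y) (hdot (X y) x) => [? ?] [? ?] /=.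
move=> -> -> h1 h2; rewrite eq_complex /=; apply/andP; split; apply/eqP; lra.
Qed.

Lemma self_adjointD X Y :
  self_adjoint X -> self_adjoint Y -> self_adjoint (X + Y).
Proof. by move=> Xs Ys x y; rewrite !bopE hdotDl hdotDr Xs Ys. Qed.

Lemma self_adjointZ a X : self_adjoint X -> self_adjoint (a%:C *: X).
Proof.
by move=> Xs x y; rewrite !bopE hdotZl hdotZr Xs conjc_real.
Qed.

Lemma self_adjoint_id : self_adjoint (bop_id H).
Proof. by []. Qed.

Lemma bop_expS X n x : bop_exp X n.+1 x = X (bop_exp X n x).
Proof. by []. Qed.

Lemma bop_expSr X n x : bop_exp X n.+1 x = bop_exp X n (X x).
Proof. by elim: n => // n IH; rewrite bop_expS IH. Qed.

Lemma self_adjoint_exp X n : self_adjoint X -> self_adjoint (bop_exp X n).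
Proof.
by move=> Xs; elim: n => // n IH x y; rewrite bop_expS Xs IH -bop_expSr.
Qed.

Lemma self_adjoint_shift X a : self_adjoint X ->
  self_adjoint (X - a%:C *: bop_id H).
Proof.
move=> Xs; rewrite -scaleNr -(rmorphN (real_complex R)).
by apply: self_adjointD => //; exact: self_adjointZ.
Qed.

Lemma rdot_shift X a x :
  rdot ((X - a%:C *: bop_id H) x) x = rdot (X x) x - a * rnorm x ^+ 2.
Proof. by rewrite !bopE !rdotE rdotxx. Qed.

(* Expand [0 <= rdot (T y) y] for [y = x - N^-1 T x]. *)
Lemma sqr_rnorm_le_rdot T N : 0 < N -> self_adjoint T ->
  (forall x, 0 <= rdot (T x) x) -> (forall x, rnorm (T x) <= N * rnorm x) ->
  forall x, rnorm (T x) ^+ 2 <= N * rdot (T x) x.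
Proof.
move=> N0 Ts Tp TN x.
have := Tp (x - N^-1%:C *: T x); rewrite linearB linearZ /= !rdotE.
rewrite (self_adjoint_rdot (T x) x Ts) rdotxx.
have := TN (T x) => /(ler_wpM2l (rnorm_ge0 (T x))).
have := rdot_rnorm (T (T x)) (T x); rewrite ler_norml => /andP[_ h1] h2 h3.
rewrite -ler_pdivrMl//.
(* The second-order term of the expansion absorbs only one of the two copies of
   [N^-1 * rnorm (T x) ^+ 2] in the first-order term. *)
have h4 : N^-1 * (N^-1 * rdot (T (T x)) (T x)) <= N^-1 * rnorm (T x) ^+ 2.
  rewrite ler_wpM2l ?invr_ge0 ?(ltW N0)// ler_pdivrMl//.
  by rewrite (le_trans h1)// mulrC (le_trans h2)// mulrCA.
lra.
Qed.

(* With [r] the imaginary part of [k], [r i (X - k)] is coercive. *)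
Lemma nonreal_invertible X (k : R[i]) : self_adjoint X -> complex.Im k != 0 ->
  bop_invertible (X - k *: bop_id H).
Proof.
move=> Xs k0; pose r := complex.Im k.
have rk : Complex 0 r != 0 :> R[i] by rewrite eq_complex /= eqxx.
rewrite -[X - _](scalerK rk); apply: bop_invertibleZ; first by rewrite invr_eq0.
apply: (@coercive_invertible _ _ _ (r ^+ 2)); first by rewrite exprn_even_gt0.
(* Coercivity holds with equality: [hdot (X x) x] is real, so after multiplication by [r i] only
   [- k] contributes to the real part. *)
move=> x; rewrite le_eqVlt; apply/orP; left; apply/eqP.
rewrite !bopE /rdot hdotZl /= hdotDl -scaleNr hdotZl hdotxx.
have := self_adjoint_Im x Xs; rewrite /r.
by case: (hdot _ _) => u v /= ->; case: (k) => ? ? /=; ring.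
Qed.

(** For [t] outside [[m, M]], either [X - t] or [t - X] is coercive, with the distance to the
    interval as constant. *)
Lemma real_spectrum_itv X m M : self_adjoint X ->
  bop_le (m%:C *: bop_id H) X -> bop_le X (M%:C *: bop_id H) ->
  forall t, real_spectrum X t -> m <= t <= M.
Proof.
move=> Xs /positive_bopP mX /positive_bopP XM t.
apply: contra_notT; rewrite negb_and -!ltNge => /orP[tm|Mt].
  apply: (@coercive_invertible _ _ _ (m - t)); first by rewrite subr_gt0.
  move=> x; have [_] := mX x; rewrite rdot_shift => h.
  by rewrite rdot_shift; lra.
rewrite -[X - _]opprK -scaleN1r; apply: bop_invertibleZ.
  by rewrite oppr_eq0 oner_eq0.
apply: (@coercive_invertible _ _ _ (t - M)); first by rewrite subr_gt0.
move=> x; have [_] := XM x; rewrite !bopE !rdotE rdotxx => h.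
by lra.
Qed.

(* [a] is the infimum of the numerical range of [T]: if [T - a] had a bounded
   inverse, [sqr_rnorm_le_rdot] would improve the lower bound [a]. *)
Lemma real_spectrum_le_rdot T x : self_adjoint T -> x != 0 ->
  exists2 a, real_spectrum T a & a * rnorm x ^+ 2 <= rdot (T x) x.
Proof.
move=> Ts x0.
have gt0 z : z != 0 -> 0 < rnorm z ^+ 2.
  by move=> z0; rewrite exprn_gt0// lt_def rnorm_ge0 rnorm_eq0 z0.
pose A := [set rdot (T y) y / rnorm y ^+ 2 | y in [set y | y != 0]].
have [N N0 NP] := bop_bounded T.
have Alb : lbound A (- N).
  move=> _ [y /= y0 <-]; rewrite ler_pdivlMr ?gt0//.
  have := rdot_rnorm (T y) y; rewrite ler_norml => /andP[+ _].
  apply: le_trans; rewrite mulNr lerN2 expr2 mulrA ler_wpM2r ?rnorm_ge0//.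
have Ainf : has_inf A.
  by split; [exists (rdot (T x) x / rnorm x ^+ 2); exists x|exists (- N)].
have Tinf y : inf A * rnorm y ^+ 2 <= rdot (T y) y.
  have [->|y0] := eqVneq y 0.
    by rewrite -rdotxx !rdot0l rdotC rdot0l mulr0.
  by rewrite -ler_pdivlMr ?gt0//; apply: ge_inf; [case: Ainf|exists y].
exists (inf A) => // inv; have /bop_invertibleP[W [WK _]] := inv.
move: inv => _; set S := _ - _ in WK.
have Ss : self_adjoint S by exact: self_adjoint_shift.
have Sp y : 0 <= rdot (S y) y by rewrite rdot_shift subr_ge0.
have [N' N'0 N'P] := bop_bounded S.
have [w w0 wP] := bop_bounded W.
have SN := sqr_rnorm_le_rdot N'0 Ss Sp N'P.
(* From [rnorm y <= w * rnorm (S y)] and [rnorm (S y) ^+ 2 <= N' * rdot (S y) y], the form of [S] is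
   at least [d * rnorm y ^+ 2]. *)
pose d := (w ^+ 2 * N')^-1.
have d0 : 0 < d by rewrite invr_gt0 mulr_gt0// exprn_gt0.
suff : inf A + d <= inf A by rewrite gerDl leNgt d0.
apply: lb_le_inf; first by case: Ainf.
move=> _ [y /= y0 <-]; rewrite ler_pdivlMr ?gt0// mulrDl -lerBrDl -rdot_shift.
rewrite -/S /d ler_pdivrMl ?mulr_gt0 ?exprn_gt0// -mulrA.
have w2 : 0 <= w ^+ 2 by rewrite sqr_ge0.
rewrite (le_trans _ (ler_wpM2l w2 (SN y)))// -exprMn.
rewrite lerXn2r// ?nnegrE ?mulr_ge0 ?rnorm_ge0 ?(ltW w0)//.
by rewrite -[in leLHS](WK y).
Qed.

End spectrum.

(** * Polynomials of an operator *)

Section polynomial_calculus.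
Context {R : realType} {H : hilbertType R}.
Implicit Types (x y z : H) (a b c : R) (X Y T : bop H).
Local Notation toC := (map_poly (real_complex R)).

(** Complex coefficients allow real polynomials to be split into linear factors. *)
Definition bop_cpoly (p : {poly R[i]}) X : bop H :=
  \sum_(i < size p) p`_i *: bop_exp X i.

Lemma bop_cpoly_wide n (p : {poly R[i]}) X : (size p <= n)%N ->
  bop_cpoly p X = \sum_(i < n) p`_i *: bop_exp X i.
Proof.
move=> pn; rewrite /bop_cpoly.
rewrite (big_ord_widen n (fun i => p`_i *: bop_exp X i) pn) big_mkcond.
apply: eq_bigr => i _; case: ltnP => // pi.
by rewrite nth_default// scale0r.
Qed.

Lemma bop_cpolyD (p q : {poly R[i]}) X :
  bop_cpoly (p + q) X = bop_cpoly p X + bop_cpoly q X.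
Proof.
rewrite (bop_cpoly_wide X (size_polyD p q)).
rewrite (bop_cpoly_wide X (leq_maxl (size p) (size q))).
rewrite (bop_cpoly_wide X (leq_maxr (size p) (size q))) -big_split.
by apply: eq_bigr => i _; rewrite coefD scalerDl.
Qed.

Lemma bop_cpolyZ (k : R[i]) (p : {poly R[i]}) X :
  bop_cpoly (k *: p) X = k *: bop_cpoly p X.
Proof.
rewrite (bop_cpoly_wide X (size_scale_leq k p)) scaler_sumr.
by apply: eq_bigr => i _; rewrite coefZ scalerA.
Qed.

Lemma bop_cpolyC (k : R[i]) X : bop_cpoly k%:P X = k *: bop_id H.
Proof. by rewrite (bop_cpoly_wide X (size_polyC_leq1 k)) big_ord1 coefC. Qed.

Lemma bop_cpolyXM (p : {poly R[i]}) X :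
  bop_cpoly ('X * p) X = bop_comp X (bop_cpoly p X).
Proof.
have pX : (size ('X * p)%R <= (size p).+1)%N.
  by rewrite (leq_trans (size_polyMleq _ _))// size_polyX.
rewrite (bop_cpoly_wide X pX) big_ord_recl coefXM scale0r add0r.
apply/bopP => x; rewrite bop_compE !bop_sumE (raddf_sum X).
by apply: eq_bigr => i _; rewrite lift0 coefXM !bopZE bop_expS -bopZr.
Qed.

Lemma bop_cpolyX X : bop_cpoly 'X X = X.
Proof. by rewrite -['X]mulr1 bop_cpolyXM bop_cpolyC scale1r; apply/bopP. Qed.

Lemma bop_cpolyM (p q : {poly R[i]}) X :
  bop_cpoly (p * q) X = bop_comp (bop_cpoly p X) (bop_cpoly q X).
Proof.
elim/poly_ind: p q => [|p k IH] q.
  rewrite mul0r -[0](polyC0) bop_cpolyC scale0r.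
  by apply/bopP.
rewrite mulrDl -mulrA mul_polyC !bop_cpolyD IH bop_cpolyZ bop_cpolyXM.
by rewrite IH bop_cpolyX bop_cpolyC; apply/bopP.
Qed.

(** Over the complex numbers [p] is a nonzero scalar times a product of factors ['X - z], each of
    which becomes invertible at [X]. *)
Lemma bop_cpoly_invertible (p : {poly R[i]}) X : p != 0 ->
  (forall z : R[i], root p z -> bop_invertible (X - z *: bop_id H)) ->
  bop_invertible (bop_cpoly p X).
Proof.
move=> p0; have [s ps] := closed_field_poly_normal p.
have lp : lead_coef p != 0 by rewrite lead_coef_eq0.
have rp (z : R[i]) : root p z = (z \in s) by rewrite ps rootZ// root_prod_XsubC.
move=> Xs; rewrite ps bop_cpolyZ; apply: bop_invertibleZ => //.
have {}Xs (z : R[i]) : z \in s -> bop_invertible (X - z *: bop_id H).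
  by move=> zs; apply: Xs; rewrite rp.
elim: s Xs {ps rp} => [_|z s IH Xs].
  rewrite big_nil bop_cpolyC scale1r.
  by apply/bop_invertibleP; exists (bop_id H); split.
rewrite big_cons bop_cpolyM; apply: bop_invertible_comp.
  rewrite -polyCN bop_cpolyD bop_cpolyC scaleNr bop_cpolyX.
  by apply: Xs; rewrite mem_head.
by apply: IH => w ws; apply: Xs; rewrite inE ws orbT.
Qed.

Lemma bop_polyE p X : bop_poly p X = bop_cpoly (toC p) X.
Proof.
rewrite /bop_cpoly size_map_poly; apply: eq_bigr => i _.
by rewrite coef_map.
Qed.

Lemma bop_polyD p q X : bop_poly (p + q) X = bop_poly p X + bop_poly q X.
Proof. by rewrite !bop_polyE rmorphD bop_cpolyD. Qed.

Lemma bop_polyZ a p X : bop_poly (a *: p) X = a%:C *: bop_poly p X.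
Proof. by rewrite !bop_polyE map_polyZ bop_cpolyZ. Qed.

Lemma bop_polyC a X : bop_poly a%:P X = a%:C *: bop_id H.
Proof. by rewrite bop_polyE map_polyC bop_cpolyC. Qed.

Lemma bop_polyX X : bop_poly 'X X = X.
Proof. by rewrite bop_polyE map_polyX bop_cpolyX. Qed.

Lemma bop_polyM p q X :
  bop_poly (p * q) X = bop_comp (bop_poly p X) (bop_poly q X).
Proof. by rewrite !bop_polyE rmorphM bop_cpolyM. Qed.

Lemma bop_polyN p X : bop_poly (- p) X = - bop_poly p X.
Proof. by rewrite -scaleN1r bop_polyZ rmorphN1 scaleN1r. Qed.

Lemma bop_polyB p q X : bop_poly (p - q) X = bop_poly p X - bop_poly q X.
Proof. by rewrite bop_polyD bop_polyN. Qed.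

Lemma self_adjoint_poly p X : self_adjoint X -> self_adjoint (bop_poly p X).
Proof.
move=> Xs; rewrite /bop_poly; elim/big_ind: _ => [x y|A B As Bs|i _].
- rewrite -(scale0r (bop_id H)) -[0](rmorph0 (real_complex R)).
  by apply: self_adjointZ.
- exact: self_adjointD.
- by apply: self_adjointZ; exact: self_adjoint_exp.
Qed.

(** One inclusion of the spectral mapping theorem. If no spectral [t] has [p.[t] = a], every root of
    [p - a] is either nonreal or a real number outside the spectrum, so [p(X) - a] is invertible.
    Excluding [p = a] keeps [p - a] nonzero. *)
Lemma real_spectrum_poly p X a : self_adjoint X -> p != a%:P ->
  real_spectrum (bop_poly p X) a -> exists2 t, real_spectrum X t & p.[t] = a.
Proof.
move=> Xs pa pXa; apply: contrapT => nX; apply: pXa.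
rewrite -(bop_polyC a X) -bop_polyB bop_polyE; apply: bop_cpoly_invertible.
  by rewrite map_poly_eq0 subr_eq0.
move=> z zr; have [z0|] := eqVneq (complex.Im z) 0; last first.
  exact: nonreal_invertible.
have zE : z = (complex.Re z)%:C by case: (z) z0 => u v /= ->.
apply: contrapT => Xz; move: zr; rewrite zE fmorph_root /root !hornerE subr_eq0.
move/eqP => pz; apply: nX; exists (complex.Re z) => //.
by rewrite /real_spectrum /spectrum/= -zE.
Qed.

Lemma positive_bop_poly p X : self_adjoint X ->
  (forall t, real_spectrum X t -> 0 <= p.[t]) -> positive_bop (bop_poly p X).
Proof.
move=> Xs p0; have Ts := self_adjoint_poly p Xs.
apply: self_adjoint_positive => // x; have [->|x0] := eqVneq x 0.
  by rewrite rdotC rdot0l.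
have [a aT] := real_spectrum_le_rdot Ts x0; apply: le_trans.
apply: mulr_ge0; last exact: sqr_ge0.
(* For constant [p], any point of the spectrum of [X] gives [0 <= a]; one exists because
   [x != 0]. *)
have [pa|pa] := eqVneq p a%:P.
  have [t tX _] := real_spectrum_le_rdot Xs x0.
  by have := p0 t tX; rewrite pa hornerC.
by have [t /p0 + <-] := real_spectrum_poly Xs pa aT.
Qed.

(** Positivity of [e ^ 2 - p ^ 2] at [X], read through self-adjointness of [p(X)]. *)
Lemma rnorm_poly p X e : self_adjoint X ->
  (forall t, real_spectrum X t -> `|p.[t]| <= e) ->
  0 <= e -> forall x, rnorm (bop_poly p X x) <= e * rnorm x.
Proof.
move=> Xs pe e0 x.
have /positive_bopP/(_ x)[_] : positive_bop (bop_poly ((e ^+ 2)%:P - p * p) X).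
  apply: positive_bop_poly => // t /pe; rewrite !hornerE subr_ge0 -expr2.
  by move=> pte; rewrite -real_normK ?num_real// lerXn2r ?nnegrE.
rewrite bop_polyB bop_polyC bop_polyM !bopE !rdotE rdotxx.
rewrite (self_adjoint_rdot _ _ (self_adjoint_poly p Xs)) rdotxx subr_ge0.
by rewrite -exprMn ler_pXn2r// nnegrE ?mulr_ge0 ?rnorm_ge0.
Qed.

End polynomial_calculus.

(** * Continuous functional calculus *)

Section functional_calculus.
Context {R : realType} {H : hilbertType R}.
Implicit Types (x y z : H) (a b c : R) (X Y T : bop H) (f : R -> R).

Let norm_set T := [set complex.Re `|T x| | x in [set x : H | `|x| <= 1]].

Lemma rnorm_le1 x : (`|x| <= 1) = (rnorm x <= 1).
Proof. by rewrite rnormE; exact: (lecR _ 1). Qed.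

Lemma norm_set_has_sup T : has_sup (norm_set T).
Proof.
split; first by exists (rnorm (T 0)), 0 => //=; rewrite normr0 ler01.
have [N N0 NP] := bop_bounded T; exists N => _ [x /= x1 <-].
rewrite -/(rnorm _) (le_trans (NP x))// ler_piMr ?(ltW N0)//.
by rewrite -rnorm_le1.
Qed.

Lemma rnorm_le_bop_norm T x : rnorm (T x) <= bop_norm T * rnorm x.
Proof.
have [->|x0] := eqVneq x 0; first by rewrite raddf0 !rnorm0 mulr0.
have nx : 0 < rnorm x by rewrite lt_def rnorm_ge0 rnorm_eq0 x0.
rewrite -ler_pdivrMr// mulrC; apply: ub_le_sup.
  by have [] := norm_set_has_sup T.
exists ((rnorm x)^-1%:C *: x) => /=.
  by rewrite rnorm_le1 rnormZ gtr0_norm ?invr_gt0// mulVf ?gt_eqF.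
by rewrite -/(rnorm _) bopZr rnormZ gtr0_norm ?invr_gt0.
Qed.

Lemma bop_norm_le T c : 0 <= c ->
  (forall x, rnorm (T x) <= c * rnorm x) -> bop_norm T <= c.
Proof.
move=> c0 Tc; apply: ge_sup; first by have [] := norm_set_has_sup T.
move=> _ [x /= x1 <-]; rewrite -/(rnorm _) (le_trans (Tc x))// ler_piMr//.
by rewrite -rnorm_le1.
Qed.

Lemma bop_norm_ge0 T : 0 <= bop_norm T.
Proof.
apply: ub_le_sup; first by have [] := norm_set_has_sup T.
by exists 0; rewrite /= ?normr0 ?ler01// raddf0 normr0.
Qed.

Lemma uniform_cvgP (A : set R) (g : nat -> R -> R) f :
  {uniform A, g @ \oo --> f} <->
  forall e, 0 < e -> \forall n \near \oo, forall t, A t -> `|g n t - f t| < e.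
Proof.
split=> [gf e e0|gf P /uniform_nbhs[E [entE EP]]].
  apply: (gf [set h | forall t, A t -> `|h t - f t| < e]).
  apply/uniform_nbhs; exists [set uv | ball uv.1 e uv.2]; split.
    exact: (entourage_ball _ (PosNum e0)).
  by move=> h hP t /hP; rewrite /ball /= distrC.
move: entE; rewrite -entourage_ballE => -[e /= e0 eE].
apply: filterS (gf e e0) => n nP; apply: EP => t At.
by apply: eE; rewrite /= /ball /= distrC; exact: nP.
Qed.

(** The positive cone is closed in norm, since both the vanishing imaginary part and the sign of the
    real part survive limits. *)
Lemma positive_bop_closed T :
  (forall e, 0 < e -> exists2 S : bop H, positive_bop S &
     forall x, rnorm (S x - T x) <= e * rnorm x) -> positive_bop T.
Proof.
move=> TP; apply/positive_bopP => x.
(* Testing against every [y] of the norm of [x] covers [y = x] for the real part and [y = i x] for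
   the imaginary part. *)
have approx e : 0 < e -> exists2 S : bop H, positive_bop S &
    forall y, rnorm y = rnorm x -> `|rdot (S x - T x) y| <= e.
  have [->|x0] := eqVneq x 0.
    by move=> e0; have [S Sp _] := TP e e0; exists S => // y _;
      rewrite (raddf0 S) (raddf0 T) subrr rdot0l normr0 ltW.
  have nx : 0 < rnorm x by rewrite lt_def rnorm_ge0 rnorm_eq0 x0.
  move=> e0; have [|S Sp SP] := TP (e / rnorm x ^+ 2).
    by rewrite divr_gt0// exprn_gt0.
  exists S => // y yx; rewrite (le_trans (rdot_rnorm _ _))// yx.
  rewrite -ler_pdivlMr// (le_trans (SP x))// le_eqVlt; apply/orP; left.
  by apply/eqP; field; rewrite gt_eqF.
split.
  apply/eqP; rewrite -normr_eq0 eq_le normr_ge0 andbT.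
  apply/ler_addgt0Pr => e e0; rewrite add0r.
  have [S Sp /(_ ('i%C *: x))] := approx e e0.
  have [+ _] := (positive_bopP S).1 Sp x.
  rewrite !Im_hdot rdotDl rdotNl => ->; rewrite sub0r normrN; apply.
  by rewrite rnormZC normc_def /= expr0n /= expr1n add0r sqrtr1 mul1r.
apply/ler_addgt0Pr => e e0; have [S Sp /(_ x erefl)] := approx e e0.
have [_] := (positive_bopP S).1 Sp x; rewrite rdotDl rdotNl ler_norml.
by move=> + /andP[_]; lra.
Qed.

(** Transfers scalar bounds between [f] and affine functions to operators: [s = 1] serves lower
    bounds on [f(X)], [s = -1] upper bounds. *)
Lemma is_fcalc_positive X Y f s a b : self_adjoint X -> is_fcalc f X Y ->
  (forall t, real_spectrum X t -> 0 <= s * f t + a * t + b) ->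
  positive_bop (s%:C *: Y + a%:C *: X + b%:C *: bop_id H).
Proof.
move=> Xs [p [/uniform_cvgP pf pY]] f0; apply: positive_bop_closed => e e0.
(* The error [|s| d] is met twice, in replacing [f(X)] by [p_n(X)] and in the shift by [|s| d] that
   makes the polynomial nonnegative on the spectrum. *)
pose d := e / (2 * (`|s| + 1)).
have s1 : 0 < `|s| + 1 by rewrite ltr_wpDl.
have d0 : 0 < d by rewrite divr_gt0// mulr_gt0.
have [n [nf nY]] : exists n,
    (forall t, real_spectrum X t -> `|(p n).[t] - f t| < d) /\
    bop_norm (bop_poly (p n) X - Y) < d.
  have /cvgrPdist_lt/(_ d d0) := pY.
  move=> /(filterI (pf d d0)) [N _ NP]; exists N.
  have [? +] := NP N (leqnn N); rewrite sub0r normrN => h.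
  by split=> //; rewrite (le_lt_trans (ler_norm _)).
exists (bop_poly (s *: p n + a *: 'X + (b + `|s| * d)%:P) X).
  apply: positive_bop_poly => // t tX.
  rewrite !(hornerD, hornerZ, hornerX, hornerC).
  have := f0 t tX; have : - (`|s| * d) <= s * ((p n).[t] - f t).
    have : `|s * ((p n).[t] - f t)| <= `|s| * d.
      by rewrite normrM ler_wpM2l// ltW// nf.
    by rewrite ler_norml => /andP[].
  by lra.
move=> x; rewrite !bop_polyD !bop_polyZ bop_polyX bop_polyC !bopE.
rewrite rmorphD scalerDl.
set B := a%:C *: X x; set C := b%:C *: x; set E := (`|s| * d)%:C *: x.
have -> : s%:C *: bop_poly (p n) X x + B + (C + E) - (s%:C *: Y x + B + C) =
    s%:C *: (bop_poly (p n) X - Y) x + E.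
  apply/eqP; rewrite subr_eq !bopE scalerBr; apply/eqP.
  by rewrite [RHS]addrACA (addrA _ _ B) subrK [E + C]addrC.
rewrite (le_trans (rnormD _ _))// !rnormZ normrM normr_id (gtr0_norm d0).
have h : rnorm ((bop_poly (p n) X - Y) x) <= d * rnorm x.
  by rewrite (le_trans (rnorm_le_bop_norm _ _))// ler_wpM2r ?rnorm_ge0// ltW.
have -> : e = 2 * (`|s| + 1) * d by rewrite /d; field; rewrite gt_eqF.
have := ler_wpM2l (normr_ge0 s) h.
have : 0 <= d * rnorm x by rewrite mulr_ge0 ?rnorm_ge0// ltW.
by lra.
Qed.

(** The approximants converge at each vector with a rate proportional to its norm, so the pointwise
    limit is linear, bounded and a limit in operator norm. *)
Lemma is_fcalc_exists X f m M : m < M -> self_adjoint X ->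
  (forall t, real_spectrum X t -> m <= t <= M) ->
  {within `[m, M], continuous f} -> exists Y, is_fcalc f X Y.
Proof.
move=> mM Xs XmM fc.
have /choice[p pP] : forall n, exists p : {poly R},
    forall t, m <= t <= M -> `|p.[t] - f t| <= n.+1%:R^-1.
  by move=> n; apply: weierstrass_approximation.
(* For [k >= n], [p_n] and [p_k] are each within [1 / (n + 1)] of [f], whence the factor 2. *)
pose d n : R := 2 * n.+1%:R^-1.
have d0 n : 0 <= d n by rewrite mulr_ge0.
have dcvg (c : R) : (d n * c) @[n --> \oo] --> 0.
  rewrite -[0](mul0r c); apply: cvgMl; rewrite -[0](mulr0 2); apply: cvgMr.
  exact: cvg_harmonic.
have pC n k x : (n <= k)%N ->
    rnorm (bop_poly (p n) X x - bop_poly (p k) X x) <= d n * rnorm x.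
  move=> nk; rewrite -[X in rnorm X]/((bop_poly (p n) X - bop_poly (p k) X) x).
  rewrite -bop_polyB; apply: rnorm_poly => // t /XmM tI; rewrite !hornerE.
  rewrite (le_trans (ler_distD (f t) _ _))// /d mulr_natl mulr2n lerD// ?pP//.
  by rewrite distrC (le_trans (pP k t tI))// lef_pV2 ?posrE// ler_nat.
have /choice[y yP] : forall x, exists z, forall n,
    rnorm (bop_poly (p n) X x - z) <= d n * rnorm x.
  by move=> x; apply: (hilbert_complete (dcvg _)) => n k /pC.
have lin_y : linear y.
  move=> k x z; apply/eqP; rewrite -subr_eq0; apply/eqP.
  pose r := rnorm (k *: x + z) + (complex.Re `|k| * rnorm x + rnorm z).
  apply: (rnorm_cvg0_eq0 (dcvg r)) => n.
  rewrite (le_trans (rnorm_dist (bop_poly (p n) X (k *: x + z)) _ _))//.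
  rewrite mulrDr lerD//; first by rewrite rnormB.
  rewrite bopDr bopZr opprD addrACA -scalerBr (le_trans (rnormD _ _))//.
  rewrite mulrDr lerD// rnormZC mulrCA ler_wpM2l//.
  by rewrite -ler0c RRe_real ?ger0_real.
have [N N0 NP] := bop_bounded (bop_poly (p 0%N) X).
have [|Y YE] := @bop_of_bounded_linear _ _ y (d 0%N + N) lin_y.
  move=> x; rewrite -[y x](subKr (bop_poly (p 0%N) X x)).
  rewrite (le_trans (rnormD _ _))// rnormN addrC mulrDl lerD//.
exists Y, p; split.
  apply/uniform_cvgP => e e0.
  have /cvgrPdist_lt/(_ e e0) := @cvg_harmonic R.
  apply: filterS => n; rewrite sub0r normrN => h t /XmM tI.
  by rewrite (le_lt_trans (pP _ _ tI))// (le_lt_trans (ler_norm _) h).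
have dcvg1 : d @ \oo --> 0.
  by have := dcvg 1; under eq_fun do rewrite mulr1.
apply: (squeeze_cvgr _ (cvg_cst 0) dcvg1); apply: nearW => n.
rewrite bop_norm_ge0/=; apply: bop_norm_le => // x.
by rewrite !bopE YE.
Qed.

(** The default 0 of [xget] is taken only when no candidate exists, which [is_fcalc_exists] rules
    out. *)
Lemma fcalcP X f m M : m < M -> self_adjoint X ->
  (forall t, real_spectrum X t -> m <= t <= M) ->
  {within `[m, M], continuous f} -> is_fcalc f X (fcalc f X).
Proof.
move=> mM Xs XmM fc; have [Y YP] := is_fcalc_exists mM Xs XmM fc.
exact: (xgetPex 0 (ex_intro _ Y YP)).
Qed.

End functional_calculus.

(** * Operator order and chords of concave functions *)

Section order.
Context {R : realType}.

(** Serves to see that [Phi (wmean v A B)] is self-adjoint, [Phi] being given only as a positive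
    map. *)
Lemma bop_le_self_adjoint (H : hilbertType R) (X : bop H) (a : R) :
  bop_le (a%:C *: bop_id H) X -> self_adjoint X.
Proof.
move=> /positive_bop_self_adjoint aX; rewrite -(subrK (a%:C *: bop_id H) X).
by apply: self_adjointD => //; apply: self_adjointZ; exact: self_adjoint_id.
Qed.

Lemma positive_bopD (H : hilbertType R) (X Y : bop H) :
  positive_bop X -> positive_bop Y -> positive_bop (X + Y).
Proof. by move=> X0 Y0 x; rewrite bopDE hdotDl addr_ge0. Qed.

Lemma positive_bopZ (H : hilbertType R) (X : bop H) (a : R) : 0 <= a ->
  positive_bop X -> positive_bop (a%:C *: X).
Proof. by move=> a0 X0 x; rewrite bopZE hdotZl mulr_ge0// ler0c. Qed.

Lemma positive_wmean (H : hilbertType R) (X Y : bop H) (v : R) :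
  0 <= v -> v <= 1 -> positive_bop X -> positive_bop Y ->
  positive_bop (wmean v X Y).
Proof.
move=> v0 v1 X0 Y0.
by apply: positive_bopD; apply: positive_bopZ => //; rewrite subr_ge0.
Qed.

Lemma positive_bop_id (H : hilbertType R) : positive_bop (bop_id H).
Proof. by move=> x; rewrite bop_idE hdotxx ler0c sqr_ge0. Qed.

Lemma wmeanD (H : hilbertType R) (v : R) (X X' Y Y' : bop H) :
  wmean v (X + X') (Y + Y') = wmean v X Y + wmean v X' Y'.
Proof. by rewrite /wmean !scalerDr addrACA. Qed.

Lemma wmeanZ (H : hilbertType R) (v : R) (k : R[i]) (X Y : bop H) :
  wmean v (k *: X) (k *: Y) = k *: wmean v X Y.
Proof. by rewrite /wmean scalerDr !scalerA ![k * _]mulrC. Qed.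

Lemma wmeanxx (H : hilbertType R) (v : R) (X : bop H) : wmean v X X = X.
Proof. by rewrite /wmean -scalerDl -rmorphD subrK scale1r. Qed.

Lemma wmeanB (H : hilbertType R) (v : R) (X X' Y Y' : bop H) :
  wmean v (X - X') (Y - Y') = wmean v X Y - wmean v X' Y'.
Proof. by rewrite wmeanD -(scaleN1r X') -(scaleN1r Y') wmeanZ scaleN1r. Qed.

Lemma linear_wmean (H K : hilbertType R) (Phi : {linear bop H -> bop K}) v X Y :
  Phi (wmean v X Y) = wmean v (Phi X) (Phi Y).
Proof. by rewrite /wmean linearD !linearZ. Qed.

Definition chord (m M : R) (f : R -> R) (t : R) : R :=
  (f M - f m) / (M - m) * (t - m) + f m.

Lemma chord_le_concave (m M : R) (f : R -> R) : m < M ->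
  concave_function `[m, M] f ->
  forall t, m <= t <= M -> chord m M f t <= f t.
Proof.
move=> mM fconc t /andP[mt tM].
have s0 : 0 < M - m by rewrite subr_gt0.
have s0' : 0 <= (M - t) / (M - m) by rewrite divr_ge0 ?subr_ge0// ltW.
have s1 : (M - t) / (M - m) <= 1 by rewrite ler_pdivrMr// mul1r lerD2l lerN2.
have mI : m \in `[m, M]%classic by rewrite inE /= in_itv/= lexx ltW.
have MI : M \in `[m, M]%classic by rewrite inE /= in_itv/= lexx ltW.
(* [s] is the weight of [m] when [t] is written as a convex combination of [m] and [M]. *)
pose s := (M - t) / (M - m).
have : - f (s * m + (1 - s) * M) <= s * - f m + (1 - s) * - f M.
  exact: (fconc (Itv01 s0' s1) m M mI MI).
have -> : s * m + (1 - s) * M = t.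
  by rewrite /s; field; rewrite gt_eqF.
rewrite -lerN2 opprK; apply: le_trans; rewrite le_eqVlt; apply/orP; left.
by apply/eqP; rewrite /chord /s; field; rewrite gt_eqF.
Qed.

Lemma le_chord_beta_tilde (m M : R) (f : R -> R) : m < M ->
  {within `[m, M], continuous f} ->
  forall t, m <= t <= M -> f t <= chord m M f t + beta_tilde m M f.
Proof.
move=> mM fc t tI; have [c cI cmax] := EVT_max (ltW mM) fc.
pose k := (f M - f m) / (M - m).
suff : f t - k * (t - m) - f m <= beta_tilde m M f by rewrite /chord -/k; lra.
apply: ub_le_sup; last by exists t.
(* The supremum needs an upper bound: [f] is at most its maximum [f c], and [- k (u - m)] at most
   [|k| (M - m)]. *)
exists (f c + `|k| * (M - m) - f m) => _ [u /= uI <-].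
have := cmax u uI; move: uI; rewrite in_itv/= => /andP[mu uM] fu.
rewrite -/k lerD2r lerD//.
have h1 := ler_wpM2l (normr_ge0 k) uM.
have := ler_wpM2r (_ : 0 <= u - m) (ler_norm (- k)); rewrite subr_ge0 normrN.
by move=> /(_ mu); lra.
Qed.

(** The chord meets [f] at [m], so the value 0 is among those bounded by [beta_tilde]. *)
Lemma beta_tilde_ge0 (m M : R) (f : R -> R) : m < M ->
  {within `[m, M], continuous f} -> 0 <= beta_tilde m M f.
Proof.
move=> mM fc; have := le_chord_beta_tilde mM fc (t := m).
by rewrite lexx ltW// /chord subrr mulr0 add0r lerDl => /(_ isT).
Qed.

End order.

Theorem theorem2 (R : realType) (H K : hilbertType R) (m M : R) (hmM : m < M)
    (A B : bop H) (hA : self_adjoint A) (hB : self_adjoint B)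
    (hmA : bop_le (m%:C *: bop_id H) A) (hAM : bop_le A (M%:C *: bop_id H))
    (hmB : bop_le (m%:C *: bop_id H) B) (hBM : bop_le B (M%:C *: bop_id H))
    (Phi : {linear bop H -> bop K})
    (hPhi : positive_map Phi) (hPhi1 : normalized_map Phi)
    (f : R -> R) (hf : {within `[m, M], continuous f})
    (hconc : concave_function `[m, M] f)
    (v : R) (hv0 : 0 <= v) (hv1 : v <= 1) :
  bop_le (fcalc f (Phi (wmean v A B)))
    (wmean v (Phi (fcalc f A)) (Phi (fcalc f B))
      + (2 * beta_tilde m M f)%:C *: bop_id K).
Proof.
set C := Phi (wmean v A B); set beta := beta_tilde m M f.
(* Writing scalars as images of means turns [C - m] and [M - C] into images under [Phi] of means of
   positive operators. *)
have Phi_id (a : R) :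
    a%:C *: bop_id K = Phi (wmean v (a%:C *: bop_id H) (a%:C *: bop_id H)).
  by rewrite wmeanxx linearZ hPhi1.
have mC : bop_le (m%:C *: bop_id K) C.
  by rewrite /bop_le Phi_id -raddfB -wmeanB; apply: hPhi; exact: positive_wmean.
have CM : bop_le C (M%:C *: bop_id K).
  by rewrite /bop_le Phi_id -raddfB -wmeanB; apply: hPhi; exact: positive_wmean.
have Cs := bop_le_self_adjoint mC.
have fA := fcalcP hmM hA (real_spectrum_itv hA hmA hAM) hf.
have fB := fcalcP hmM hB (real_spectrum_itv hB hmB hBM) hf.
have fC := fcalcP hmM Cs (real_spectrum_itv Cs mC CM) hf.
pose k := (f M - f m) / (M - m); pose c := f m - k * m.
have chordE t : chord m M f t = k * t + c by rewrite /chord /c -/k; ring.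
have lower X : self_adjoint X -> bop_le (m%:C *: bop_id H) X ->
    bop_le X (M%:C *: bop_id H) -> is_fcalc f X (fcalc f X) ->
    positive_bop (fcalc f X - (k%:C *: X + c%:C *: bop_id H)).
  move=> Xs mX XM fX; rewrite opprD addrA -!scaleNr -!rmorphN.
  rewrite -[fcalc f X]scale1r -(rmorph1 (real_complex R)).
  apply: (is_fcalc_positive Xs fX) => t /(real_spectrum_itv Xs mX XM) tI.
  by have := chord_le_concave hmM hconc tI; rewrite chordE; lra.
have upper : positive_bop
    ((-1)%:C *: fcalc f C + k%:C *: C + (c + beta)%:C *: bop_id K).
  apply: (is_fcalc_positive Cs fC) => t /(real_spectrum_itv Cs mC CM) tI.
  by have := le_chord_beta_tilde hmM hf tI; rewrite chordE -/beta; lra.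
have lowerA := lower A hA hmA hAM fA; have lowerB := lower B hB hmB hBM fB.
have := hPhi _ (positive_wmean hv0 hv1 lowerA lowerB).
(* The chord is affine and [Phi] is unital, so the two chords at [A] and [B] merge into [k C + c],
   the chord occurring in [upper]. *)
rewrite wmeanB wmeanD !wmeanZ wmeanxx linearB linear_wmean linearD !linearZ /=.
rewrite hPhi1 -/C => lowerC.
(* [lowerC] and [upper] add up to the bound with one [beta]; the positive term [beta I] raises the
   factor to 2. *)
have beta0 := positive_bopZ (beta_tilde_ge0 hmM hf) (@positive_bop_id _ K).
have := positive_bopD (positive_bopD lowerC upper) beta0.
rewrite -/beta /bop_le; congr positive_bop.
have -> : (2 * beta)%:C = beta%:C + beta%:C :> R[i].
  by rewrite -rmorphD mulr_natl mulr2n.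
have -> : (c + beta)%:C = c%:C + beta%:C :> R[i] by rewrite rmorphD.
rewrite rmorphN1 scaleN1r !scalerDl; set P := k%:C *: C.
rewrite [- fcalc f C + P]addrC (addrACA P) [X in X + _ = _]addrA subrK -!addrA.
congr (_ + _).
by congr (_ + _); rewrite addrC -addrA.
Qed.
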